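(* (In $\mathbf{ZF}$.) (i) For every sequential space $\mathbf{X}$, $\mathbf{WUF}(\mathbf{X})$ holds. (ii) For every second-countable metrizable Loeb space $\mathbf{X}$, $\mathbf{WUF}(\mathbf{X})$ holds. (iii) For every Hausdorff space $\mathbf{X}$, $\mathbf{WUF}(\mathbf{X})$ implies $\mathbf{CUF}(\mathbf{X})$. (iv) For every $k$-space $\mathbf{X}$, $\mathbf{WUF}(\mathbf{X})$ and $\mathbf{CUF}(\mathbf{X})$ are equivalent.
   Context: The result is a theorem of $\mathbf{ZF}$ (Zermelo–Fraenkel set theory without the axiom of choice). $\mathbf{WUF}(\mathbf{X})$: for every closed subset $F$ of the space $\mathbf{X}$ and every accumulation point $x$ of $F$ in $\mathbf{X}$, there exists a sequence of points of $F\setminus\{x\}$ which converges in $\mathbf{X}$ to $x$. $\mathbf{CUF}(\mathbf{X})$: for every compact subset $F$ of $\mathbf{X}$ and every accumulation point $x$ of $F$ in $\mathbf{X}$, there exists a sequence of points of $F\setminus\{x\}$ which converges in $\mathbf{X}$ to $x$. A set $A\subseteq X$ is sequentially closed in $\mathbf{X}$ if every point of $X$ which is a limit of a sequence of points of $A$ converging in $\mathbf{X}$ belongs to $A$. A space is sequential if its sequentially closed sets are exactly its closed sets. A topological space is Loeb if the family of all its non-empty closed subsets has a choice function. A space $\mathbf{X}$ is a $k$-space if it is Hausdorff and every set $A\subseteq X$, such that $A\cap K$ is closed in $\mathbf{X}$ for every compact $K\subseteq X$, is closed in $\mathbf{X}$. *)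

(* Defs.v *)
(* "phi is a theorem of ZF" is rendered semantically: phi holds in every model
   of first-order ZF.  Everything below (spaces, sequences, real numbers,
   choice functions, ...) is an element of the model, and all quantifiers range
   over the model, so a choice principle of the ambient logic does not provide
   choice functions or sequences inside the model.  Ready-made libraries of
   topology are not used because their carriers come with choice operators. *)

Set Implicit Arguments.
Unset Strict Implicit.

Record set_structure : Type := SetStructure {
  carrier :> Type;
  mem : carrier -> carrier -> Prop
}.

Notation "x ∈ y" := (mem x y) (at level 70, no associativity).
Notation "x ∉ y" := (~ mem x y) (at level 70, no associativity).
Notation "x ⊆ y" := (forall t, mem t x -> mem t y)
  (at level 70, no associativity).

(* First-order formulas of the language {=, ∈}, with de Bruijn variables.
   They index the two axiom schemes; since the schemes range over formulas
   only, and not over all predicates of the ambient logic, this is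
   first-order ZF and not second-order ZF. *)
Inductive formula : Type :=
| FEq (i j : nat)
| FMem (i j : nat)
| FBot
| FImp (p q : formula)
| FAnd (p q : formula)
| FOr (p q : formula)
| FAll (p : formula)
| FEx (p : formula).

Definition scons {A : Type} (a : A) (e : nat -> A) (n : nat) : A :=
  match n with
  | O => a
  | S m => e m
  end.

Fixpoint sat (M : set_structure) (e : nat -> M) (p : formula) : Prop :=
  match p with
  | FEq i j => e i = e j
  | FMem i j => e i ∈ e j
  | FBot => False
  | FImp p q => sat e p -> sat e q
  | FAnd p q => sat e p /\ sat e q
  | FOr p q => sat e p \/ sat e q
  | FAll p => forall a : M, sat (scons a e) p
  | FEx p => exists a : M, sat (scons a e) p
  end.

Section SetTheory.

Variable M : set_structure.
Implicit Types a b c d e f n p r s t u v w x y z : M.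

Definition is_empty z : Prop := forall t, t ∉ z.

Definition is_upair z a b : Prop := forall t, t ∈ z <-> t = a \/ t = b.

(* Kuratowski pair: p = {{a}, {a, b}} *)
Definition is_opair p a b : Prop :=
  exists u v, is_upair u a a /\ is_upair v a b /\ is_upair p u v.

Definition is_union u a : Prop := forall t, t ∈ u <-> exists b, b ∈ a /\ t ∈ b.

Definition is_inter z a b : Prop := forall t, t ∈ z <-> t ∈ a /\ t ∈ b.

Definition is_diff z a b : Prop := forall t, t ∈ z <-> t ∈ a /\ t ∉ b.

Definition is_remove z a x : Prop := forall t, t ∈ z <-> t ∈ a /\ t <> x.

Definition is_succ s n : Prop := forall t, t ∈ s <-> t ∈ n \/ t = n.

Definition inductive_set a : Prop :=
  (exists z, is_empty z /\ z ∈ a) /\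
  (forall n, n ∈ a -> exists s, is_succ s n /\ s ∈ a).

Definition is_omega w : Prop :=
  inductive_set w /\ (forall a, inductive_set a -> w ⊆ a).

Record ZF : Prop := {
  ZF_extensionality :
    forall a b, (forall t, t ∈ a <-> t ∈ b) -> a = b;
  ZF_foundation :
    forall a, (exists x, x ∈ a) ->
      exists x, x ∈ a /\ forall y, y ∈ a -> y ∉ x;
  ZF_pairing :
    forall a b, exists z, is_upair z a b;
  ZF_union :
    forall a, exists u, is_union u a;
  ZF_powerset :
    forall a, exists z, forall x, x ∈ z <-> x ⊆ a;
  ZF_infinity :
    exists a, inductive_set a;
  (* variable 0 of phi is x, the others are parameters *)
  ZF_separation :
    forall (phi : formula) (env : nat -> M) a,
      exists z, forall x, x ∈ z <-> x ∈ a /\ sat (scons x env) phi;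
  (* variable 0 of phi is x, variable 1 is y, the others are parameters *)
  ZF_replacement :
    forall (phi : formula) (env : nat -> M) a,
      (forall x y y', x ∈ a ->
         sat (scons x (scons y env)) phi ->
         sat (scons x (scons y' env)) phi -> y = y') ->
      exists z, forall y,
        y ∈ z <-> exists x, x ∈ a /\ sat (scons x (scons y env)) phi
}.

(* (a, b) ∈ r; when r is a function this reads r(a) = b *)
Definition related r a b : Prop := exists p, is_opair p a b /\ p ∈ r.

(* r(a, b) = c for a function r of two variables *)
Definition related2 r a b c : Prop :=
  exists p, is_opair p a b /\ related r p c.

Definition is_relation r a b : Prop :=
  forall p, p ∈ r -> exists x y, x ∈ a /\ y ∈ b /\ is_opair p x y.

Definition is_function f a b : Prop :=
  is_relation f a b /\ forall x, x ∈ a -> exists! y, related f x y.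

Definition is_function2 f a b c : Prop :=
  (forall t, t ∈ f -> exists x y z p,
     x ∈ a /\ y ∈ b /\ z ∈ c /\ is_opair p x y /\ is_opair t p z) /\
  (forall x y, x ∈ a -> y ∈ b -> exists! z, related2 f x y z).

Definition is_injection f a b : Prop :=
  is_function f a b /\
  forall x x' y, related f x y -> related f x' y -> x = x'.

Definition is_bijection f a b : Prop :=
  is_injection f a b /\ forall y, y ∈ b -> exists x, related f x y.

Definition finite a : Prop :=
  exists w n f, is_omega w /\ n ∈ w /\ is_bijection f n a.

Definition countable a : Prop :=
  exists w f, is_omega w /\ is_injection f a w.

Definition is_sequence s a : Prop :=
  exists w, is_omega w /\ is_function s w a.

(* The real numbers, as a Dedekind-complete ordered field. *)

Definition less le a b : Prop := related le a b /\ a <> b.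

Record is_reals (R zero one add mul le : M) : Prop := {
  add_function : is_function2 add R R R;
  mul_function : is_function2 mul R R R;
  le_relation : is_relation le R R;
  zero_in : zero ∈ R;
  one_in : one ∈ R;
  one_neq_zero : one <> zero;
  add_assoc : forall a b c ab bc s, a ∈ R -> b ∈ R -> c ∈ R ->
    related2 add a b ab -> related2 add b c bc ->
    related2 add ab c s -> related2 add a bc s;
  add_comm : forall a b s, a ∈ R -> b ∈ R ->
    related2 add a b s -> related2 add b a s;
  add_zero : forall a, a ∈ R -> related2 add a zero a;
  add_opp : forall a, a ∈ R -> exists b, b ∈ R /\ related2 add a b zero;
  mul_assoc : forall a b c ab bc s, a ∈ R -> b ∈ R -> c ∈ R ->
    related2 mul a b ab -> related2 mul b c bc ->
    related2 mul ab c s -> related2 mul a bc s;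
  mul_comm : forall a b s, a ∈ R -> b ∈ R ->
    related2 mul a b s -> related2 mul b a s;
  mul_one : forall a, a ∈ R -> related2 mul a one a;
  mul_inv : forall a, a ∈ R -> a <> zero ->
    exists b, b ∈ R /\ related2 mul a b one;
  mul_add_distr : forall a b c bc ab ac s, a ∈ R -> b ∈ R -> c ∈ R ->
    related2 add b c bc -> related2 mul a b ab -> related2 mul a c ac ->
    related2 mul a bc s -> related2 add ab ac s;
  le_total : forall a b, a ∈ R -> b ∈ R -> related le a b \/ related le b a;
  le_antisym : forall a b, related le a b -> related le b a -> a = b;
  le_trans : forall a b c, related le a b -> related le b c -> related le a c;
  add_le : forall a b c ac bc, a ∈ R -> b ∈ R -> c ∈ R -> related le a b ->
    related2 add a c ac -> related2 add b c bc -> related le ac bc;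
  mul_nonneg : forall a b s, related le zero a -> related le zero b ->
    related2 mul a b s -> related le zero s;
  le_complete : forall S : M, S ⊆ R -> (exists a, a ∈ S) ->
    (exists b, b ∈ R /\ forall a, a ∈ S -> related le a b) ->
    exists b, b ∈ R /\ (forall a, a ∈ S -> related le a b) /\
      (forall c, c ∈ R -> (forall a, a ∈ S -> related le a c) ->
         related le b c)
}.

Record is_metric (X dist R zero add le : M) : Prop := {
  dist_function : is_function2 dist X X R;
  dist_nonneg : forall x y r, x ∈ X -> y ∈ X ->
    related2 dist x y r -> related le zero r;
  dist_zero : forall x y, x ∈ X -> y ∈ X ->
    (related2 dist x y zero <-> x = y);
  dist_sym : forall x y r, x ∈ X -> y ∈ X ->
    related2 dist x y r -> related2 dist y x r;
  dist_triangle : forall x y z a b c s, x ∈ X -> y ∈ X -> z ∈ X ->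
    related2 dist x y a -> related2 dist y z b -> related2 dist x z c ->
    related2 add a b s -> related le c s
}.

(* A topological space is a set X together with its set T of open sets. *)

Implicit Types X T A B C F K U V W D : M.

Record is_topology X T : Prop := {
  open_sub : forall U, U ∈ T -> U ⊆ X;
  open_empty : exists U, is_empty U /\ U ∈ T;
  open_whole : X ∈ T;
  open_inter : forall U V, U ∈ T -> V ∈ T -> exists W, is_inter W U V /\ W ∈ T;
  open_union : forall C, C ⊆ T -> exists U, is_union U C /\ U ∈ T
}.

Definition is_closed X T A : Prop :=
  A ⊆ X /\ exists U, is_diff U X A /\ U ∈ T.

Definition covers C A : Prop := forall x, x ∈ A -> exists U, U ∈ C /\ x ∈ U.

Definition is_compact X T K : Prop :=
  K ⊆ X /\
  forall C, C ⊆ T -> covers C K ->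
    exists D, D ⊆ C /\ finite D /\ covers D K.

Definition hausdorff X T : Prop :=
  forall x y, x ∈ X -> y ∈ X -> x <> y ->
    exists U V, U ∈ T /\ V ∈ T /\ x ∈ U /\ y ∈ V /\
      forall t, t ∈ U -> t ∉ V.

Definition accumulation_point X T A x : Prop :=
  x ∈ X /\
  forall U, U ∈ T -> x ∈ U -> exists y, y ∈ U /\ y ∈ A /\ y <> x.

(* On natural numbers, m ∈ n is the strict order m < n. *)
Definition converges X T s x : Prop :=
  is_sequence s X /\ x ∈ X /\
  forall U, U ∈ T -> x ∈ U ->
    exists w n, is_omega w /\ n ∈ w /\
      forall m, m ∈ w -> n ∈ m \/ n = m -> forall y, related s m y -> y ∈ U.

Definition sequentially_closed X T A : Prop :=
  A ⊆ X /\
  forall s x, is_sequence s A -> converges X T s x -> x ∈ A.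

Definition sequential X T : Prop :=
  forall A, sequentially_closed X T A <-> is_closed X T A.

Definition WUF X T : Prop :=
  forall F x, is_closed X T F -> accumulation_point X T F x ->
    exists A s, is_remove A F x /\ is_sequence s A /\ converges X T s x.

Definition CUF X T : Prop :=
  forall F x, is_compact X T F -> accumulation_point X T F x ->
    exists A s, is_remove A F x /\ is_sequence s A /\ converges X T s x.

Definition k_space X T : Prop :=
  hausdorff X T /\
  forall A, A ⊆ X ->
    (forall K, is_compact X T K ->
       exists I : M, is_inter I A K /\ is_closed X T I) ->
    is_closed X T A.

Definition loeb X T : Prop :=
  exists C f,
    (forall F, F ∈ C <-> is_closed X T F /\ exists x, x ∈ F) /\
    is_function f C X /\
    (forall F, F ∈ C -> exists x, x ∈ F /\ related f F x).

Definition is_base T B : Prop :=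
  B ⊆ T /\ forall U, U ∈ T -> exists C, C ⊆ B /\ is_union U C.

Definition second_countable T : Prop := exists B, is_base T B /\ countable B.

Definition metrizable X T : Prop :=
  exists R zero one add mul le dist : M,
    is_reals R zero one add mul le /\
    is_metric X dist R zero add le /\
    forall U, U ∈ T <->
      U ⊆ X /\
      forall x, x ∈ U ->
        exists r, r ∈ R /\ less le zero r /\
          forall y b, y ∈ X -> related2 dist x y b -> less le b r -> y ∈ U.

End SetTheory.

(* Main.v *)
From Stdlib Require Import Classical.
Require Import Defs.

(** Everything takes place inside a model of ZF, so each set that the argument
    uses (a cover, a sequence, the set of values of an induction hypothesis)
    must be cut out by a first-order formula.  The tactic [definability] builds
    that formula from the shape of the predicate, with the sets in the context
    as parameters; [omega_induction], [omega_least] and [function_graph] are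
    the resulting tools.

    (i) If no sequence of F \ {x} converged to x, then F \ {x} would be
    sequentially closed: limits of its sequences lie in F, because F is
    sequentially closed, and differ from x.  Being then closed, F \ {x} would
    not accumulate at x.

    (ii) A metrizable space is T1 and regular ([metric_T1_space],
    [metric_regular]), and the rest is topology.  Enumerate a countable base B
    by an injection g into omega.  For each n, the basic neighbourhoods of x
    of index below n have an open intersection; F has a point other than x in
    it, and by regularity this point lies in a basic set U whose closure avoids
    x and is contained in all of these neighbourhoods.  Let U(n) be the
    admissible U of least index, and let s(n) be the point of F ∩ cl U(n)
    that the choice function on closed sets returns.  No choice was made,
    so s is a sequence in the model; it lies in F \ {x} and converges to x.

    (iii) A compact set K in a Hausdorff space is closed ([compact_closed]).
    To avoid choosing neighbourhoods, cover K by all the open sets that are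
    disjoint from some neighbourhood of x, and show by induction along the
    finite subcover that a single neighbourhood of x is disjoint from all of
    its members.

    (iv) If x is an accumulation point of F, then F \ {x} is not closed, so in
    a k-space (F \ {x}) ∩ K is not closed for some compact K.  As F ∩ K is
    closed, x is an accumulation point of the compact set F ∩ K, and CUF gives
    the sequence. *)

Set Implicit Arguments.
Unset Strict Implicit.

(** * First-order definability *)

Section Definability.

Variable M : set_structure.

(** First-order definability of a unary predicate; the environment holds the
    parameters. *)
Definition definable (P : M -> Prop) : Prop :=
  exists phi env, forall x, sat (scons x env) phi <-> P x.

(** The same for a binary predicate, with the order of variables of the
    replacement scheme. *)
Definition definable2 (P : M -> M -> Prop) : Prop :=
  exists phi env, forall x y, sat (scons x (scons y env)) phi <-> P x y.

Variable e : nat -> M.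

Lemma sat_not p A : (sat e p <-> A) -> (sat e (FImp p FBot) <-> ~ A).
Proof. simpl; tauto. Qed.

Lemma sat_imp p q A B : (sat e p <-> A) -> (sat e q <-> B) ->
  (sat e (FImp p q) <-> (A -> B)).
Proof. simpl; tauto. Qed.

Lemma sat_and p q A B : (sat e p <-> A) -> (sat e q <-> B) ->
  (sat e (FAnd p q) <-> A /\ B).
Proof. simpl; tauto. Qed.

Lemma sat_or p q A B : (sat e p <-> A) -> (sat e q <-> B) ->
  (sat e (FOr p q) <-> A \/ B).
Proof. simpl; tauto. Qed.

Lemma sat_iff p q A B : (sat e p <-> A) -> (sat e q <-> B) ->
  (sat e (FAnd (FImp p q) (FImp q p)) <-> (A <-> B)).
Proof. simpl; tauto. Qed.

Lemma sat_all p (A : M -> Prop) : (forall a, sat (scons a e) p <-> A a) ->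
  (sat e (FAll p) <-> forall a, A a).
Proof. intros H; simpl; split; intros K a; apply H, K. Qed.

Lemma sat_ex p (A : M -> Prop) : (forall a, sat (scons a e) p <-> A a) ->
  (sat e (FEx p) <-> exists a, A a).
Proof. intros H; simpl; split; intros [a K]; exists a; apply H, K. Qed.

End Definability.

(* Extends e by every set of the context. *)
Ltac collect_parameters e :=
  match goal with
  | x : carrier _ |- _ =>
      lazymatch e with
      | context [x] => fail
      | _ => collect_parameters constr:(scons x e)
      end
  | _ => e
  end.

(* The last entry repeats for ever, as environments are infinite. *)
Ltac parameters :=
  match goal with
  | x : carrier _ |- _ => collect_parameters constr:(fun _ : nat => x)
  end.

Ltac variable_index e x :=
  lazymatch e with
  | scons x _ => constr:(O)
  | scons _ ?e' => let n := variable_index e' x in constr:(S n)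
  | (fun _ => x) => constr:(O)
  end.

Ltac head_symbol t := lazymatch t with ?f _ => head_symbol f | _ => t end.

(* Solves [sat e ?phi <-> Q] by following the structure of [Q]; a predicate that
   is not a connective, a quantifier or an atom is unfolded. *)
Ltac reify :=
  cbv beta;
  lazymatch goal with
  | |- sat ?e _ <-> (mem ?x ?y) =>
      let i := variable_index e x in
      let j := variable_index e y in
      exact (iff_refl (sat e (FMem i j)))
  | |- sat ?e _ <-> (?x = ?y) =>
      let i := variable_index e x in
      let j := variable_index e y in
      exact (iff_refl (sat e (FEq i j)))
  | |- sat _ _ <-> (~ _) => eapply sat_not; reify
  | |- sat _ _ <-> (_ /\ _) => eapply sat_and; [reify | reify]
  | |- sat _ _ <-> (_ \/ _) => eapply sat_or; [reify | reify]
  | |- sat _ _ <-> (_ <-> _) => eapply sat_iff; [reify | reify]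
  | |- sat _ _ <-> (ex ?A) => eapply (sat_ex (A := A)); intro; reify
  | |- sat _ _ <-> (?A -> ?B) => eapply (sat_imp (A := A) (B := B)); [reify | reify]
  | |- sat _ _ <-> (forall a, @?A a) => eapply (sat_all (A := A)); intro; reify
  | |- sat _ _ <-> ?Q => let h := head_symbol Q in unfold h; reify
  end.

Ltac definability :=
  let e := parameters in
  lazymatch goal with
  | |- definable _ => eexists; exists e; intro; reify
  | |- definable2 _ => eexists; exists e; intros ? ?; reify
  end.

(** * Sets, pairs and functions *)

Section Sets.

Variable M : set_structure.
Hypothesis HZF : ZF M.
Implicit Types a b c d f k m n p q r s t u v w x y z : M.

Lemma set_ext a b : (forall t, t ∈ a <-> t ∈ b) -> a = b.
Proof. apply (ZF_extensionality HZF). Qed.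

Lemma separation (P : M -> Prop) a : definable P ->
  exists z, forall x, x ∈ z <-> x ∈ a /\ P x.
Proof.
intros (phi & env & H). destruct (ZF_separation HZF phi env a) as [z Hz].
exists z; intro x. rewrite Hz, H. tauto.
Qed.

Lemma is_upair_unique p q a b : is_upair p a b -> is_upair q a b -> p = q.
Proof. intros H K. apply set_ext; intro t. rewrite (H t), (K t). tauto. Qed.

Lemma is_opair_exists a b : exists p, is_opair p a b.
Proof.
destruct (ZF_pairing HZF a a) as [u Hu].
destruct (ZF_pairing HZF a b) as [v Hv].
destruct (ZF_pairing HZF u v) as [p Hp].
exists p, u, v; auto.
Qed.

Lemma is_opair_unique p q a b : is_opair p a b -> is_opair q a b -> p = q.
Proof.
intros (u & v & Hu & Hv & Hp) (u' & v' & Hu' & Hv' & Hq).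
rewrite (is_upair_unique Hu' Hu), (is_upair_unique Hv' Hv) in Hq.
exact (is_upair_unique Hp Hq).
Qed.

Lemma is_upair_inj p a b c d : is_upair p a b -> is_upair p c d ->
  a = c /\ b = d \/ a = d /\ b = c.
Proof.
intros H K.
assert (Ha : a = c \/ a = d) by (apply K, H; auto).
assert (Hb : b = c \/ b = d) by (apply K, H; auto).
assert (Hc : c = a \/ c = b) by (apply H, K; auto).
assert (Hd : d = a \/ d = b) by (apply H, K; auto).
intuition congruence.
Qed.

Lemma is_opair_inj p a b a' b' : is_opair p a b -> is_opair p a' b' ->
  a = a' /\ b = b'.
Proof.
intros (u & v & Hu & Hv & Hp) (u' & v' & Hu' & Hv' & Hq).
destruct (is_upair_inj Hp Hq) as [[-> ->] | [-> ->]].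
- pose proof (is_upair_inj Hu Hu'). pose proof (is_upair_inj Hv Hv').
  intuition congruence.
- pose proof (is_upair_inj Hu Hv'). pose proof (is_upair_inj Hv Hu').
  intuition congruence.
Qed.

Lemma related_domain f a b x y : is_relation f a b -> related f x y ->
  x ∈ a /\ y ∈ b.
Proof.
intros H (p & Hp & Hf). destruct (H p Hf) as (x' & y' & Hx & Hy & Hp').
destruct (is_opair_inj Hp Hp') as [-> ->]; auto.
Qed.

Lemma function_unique f a b x y y' : is_function f a b ->
  related f x y -> related f x y' -> y = y'.
Proof.
intros [H K] Hy Hy'. destruct (related_domain H Hy) as [Hx _].
destruct (K x Hx) as (z & _ & Hz). rewrite <- (Hz y Hy); auto.
Qed.

(** Replacement along a definable functional P; definability is asked of the
    map from x to the pair (x, y), whose values make up the graph. *)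
Lemma function_graph (P : M -> M -> Prop) a b :
  definable2 (fun x p => exists y, P x y /\ is_opair p x y) ->
  (forall x, x ∈ a -> exists y, P x y) ->
  (forall x y y', x ∈ a -> P x y -> P x y' -> y = y') ->
  (forall x y, x ∈ a -> P x y -> y ∈ b) ->
  exists f, is_function f a b /\
    forall x y, related f x y <-> x ∈ a /\ P x y.
Proof.
intros (phi & env & H) Hex Huniq Hb.
destruct (ZF_replacement HZF (phi := phi) (env := env) (a := a))
  as [f Hf].
{ intros x p p' Hx Hp Hp'. apply H in Hp, Hp'.
  destruct Hp as (y & Hy & Hp), Hp' as (y' & Hy' & Hp').
  rewrite (Huniq x y' y Hx Hy' Hy) in Hp'. exact (is_opair_unique Hp Hp'). }
assert (Hrel : forall x y, related f x y <-> x ∈ a /\ P x y).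
{ intros x y. split.
  - intros (p & Hp & Hpf). apply Hf in Hpf. destruct Hpf as (x' & Hx' & K).
    apply H in K. destruct K as (y' & Hy' & Hp').
    destruct (is_opair_inj Hp Hp') as [-> ->]; auto.
  - intros [Hx Hy]. destruct (is_opair_exists x y) as [p Hp].
    exists p; split; [exact Hp|]. apply Hf. exists x; split; [exact Hx|].
    apply H; eauto. }
exists f; split; [split|exact Hrel].
- intros p Hp. apply Hf in Hp. destruct Hp as (x & Hx & K).
  apply H in K. destruct K as (y & Hy & Hp). exists x, y; eauto.
- intros x Hx. destruct (Hex x Hx) as [y Hy]. exists y; split.
  + apply Hrel; auto.
  + intros y' Hy'. apply Hrel in Hy'. apply (Huniq x); tauto.
Qed.

Lemma adjoin_exists a b : exists z, forall t, t ∈ z <-> t ∈ a \/ t = b.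
Proof.
destruct (ZF_pairing HZF b b) as [s Hs].
destruct (ZF_pairing HZF a s) as [p Hp].
destruct (ZF_union HZF p) as [z Hz].
exists z; intro t. rewrite (Hz t). split.
- intros (c & Hc & Ht). apply Hp in Hc. destruct Hc as [-> | ->]; [auto|].
  apply Hs in Ht. tauto.
- intros [Ht | ->].
  + exists a; split; [apply Hp|]; auto.
  + exists s; split; [apply Hp|apply Hs]; auto.
Qed.

Lemma mem_irrefl a : a ∉ a.
Proof.
intro Ha. destruct (ZF_pairing HZF a a) as [s Hs].
destruct (ZF_foundation HZF (a := s)) as (x & Hx & K).
- exists a; apply Hs; auto.
- assert (x = a) as -> by (apply Hs in Hx; tauto). exact (K a Hx Ha).
Qed.

(** ** Natural numbers *)

Lemma is_succ_unique n s s' : is_succ s n -> is_succ s' n -> s = s'.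
Proof. intros H K. apply set_ext; intro t. rewrite (H t), (K t). tauto. Qed.

Lemma is_empty_unique a b : is_empty a -> is_empty b -> a = b.
Proof.
intros H K. apply set_ext; intro t. split; intro Ht;
  [destruct (H t Ht) | destruct (K t Ht)].
Qed.

Lemma is_omega_unique w w' : is_omega w -> is_omega w' -> w = w'.
Proof.
intros [H K] [H' K']. apply set_ext; intro t; split; [apply K | apply K']; auto.
Qed.

Lemma omega_zero w z : is_omega w -> is_empty z -> z ∈ w.
Proof.
intros [[(z' & Hz' & Hw) _] _] Hz. rewrite (is_empty_unique Hz Hz'); auto.
Qed.

Lemma omega_succ w n s : is_omega w -> n ∈ w -> is_succ s n -> s ∈ w.
Proof.
intros [[_ H] _] Hn Hs. destruct (H n Hn) as (s' & Hs' & Hw).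
rewrite (is_succ_unique Hs Hs'); auto.
Qed.

Lemma omega_induction w (P : M -> Prop) : is_omega w -> definable P ->
  (forall z, is_empty z -> P z) ->
  (forall n s, n ∈ w -> is_succ s n -> P n -> P s) ->
  forall n, n ∈ w -> P n.
Proof.
intros Hw HP H0 HS. destruct (separation w HP) as [a Ha].
assert (Hind : inductive_set a).
{ split.
  - destruct Hw as [[(z & Hz & Hzw) _] _]. exists z; split; [exact Hz|].
    apply Ha; auto.
  - intros n Hn. apply Ha in Hn. destruct Hn as [Hn HPn].
    destruct (adjoin_exists n n) as [s Hs]. exists s; split; [exact Hs|].
    apply Ha; split; [exact (omega_succ Hw Hn Hs) | exact (HS n s Hn Hs HPn)]. }
intros n Hn. apply Ha. destruct Hw as [_ Hmin]. exact (Hmin a Hind n Hn).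
Qed.

Lemma omega_transitive w n m : is_omega w -> n ∈ w -> m ∈ n -> m ∈ w.
Proof.
intros Hw Hn. revert m. revert n Hn. refine (omega_induction Hw _ _ _); cbv beta.
- definability.
- intros z Hz m Hm. destruct (Hz m Hm).
- intros n s Hn Hs IH m Hm. apply Hs in Hm. destruct Hm as [Hm | ->]; auto.
Qed.

Lemma nat_transitive w n m k : is_omega w -> n ∈ w -> m ∈ n -> k ∈ m -> k ∈ n.
Proof.
intros Hw Hn. revert m k. revert n Hn. refine (omega_induction Hw _ _ _); cbv beta.
- definability.
- intros z Hz m k Hm. destruct (Hz m Hm).
- intros n s Hn Hs IH m k Hm Hk. apply Hs. left.
  apply Hs in Hm. destruct Hm as [Hm | ->]; eauto.
Qed.

Lemma zero_least w n z : is_omega w -> n ∈ w -> is_empty z -> z = n \/ z ∈ n.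
Proof.
intros Hw Hn Hz. revert n Hn. refine (omega_induction Hw _ _ _); cbv beta.
- definability.
- intros z' Hz'. left. exact (is_empty_unique Hz Hz').
- intros n s Hn Hs [-> | H]; right; apply Hs; auto.
Qed.

Lemma succ_least w n m s : is_omega w -> n ∈ w -> m ∈ n -> is_succ s m ->
  s ∈ n \/ s = n.
Proof.
intros Hw Hn Hm Hs. revert n Hn Hm. refine (omega_induction Hw _ _ _); cbv beta.
- definability.
- intros z Hz Hm. destruct (Hz m Hm).
- intros n s' Hn Hs' IH Hm. apply Hs' in Hm. destruct Hm as [Hm | ->].
  + left; apply Hs'. auto.
  + right. exact (is_succ_unique Hs Hs').
Qed.

Lemma nat_trichotomy w m n : is_omega w -> m ∈ w -> n ∈ w ->
  m ∈ n \/ m = n \/ n ∈ m.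
Proof.
intros Hw Hm. revert n. revert m Hm. refine (omega_induction Hw _ _ _); cbv beta.
- definability.
- intros z Hz n Hn. destruct (zero_least Hw Hn Hz); auto.
- intros m s Hm Hs IH n Hn. destruct (IH n Hn) as [H | [-> | H]].
  + destruct (succ_least Hw Hn H Hs); auto.
  + right; right. apply Hs; auto.
  + right; right. apply Hs; auto.
Qed.

(** The minimal element comes from foundation; it is unique by
    [nat_trichotomy]. *)
Lemma omega_least w (P : M -> Prop) : definable P ->
  (exists n, n ∈ w /\ P n) ->
  exists n, n ∈ w /\ P n /\ forall m, m ∈ w -> P m -> m ∉ n.
Proof.
intros HP (n & Hn & HPn). destruct (separation w HP) as [a Ha].
destruct (ZF_foundation HZF (a := a)) as (k & Hk & K).
- exists n; apply Ha; auto.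
- apply Ha in Hk. destruct Hk as [Hk HPk]. exists k; repeat split; auto.
  intros m Hm HPm. apply K. apply Ha; auto.
Qed.

(** ** Finite sets *)

Lemma finite_empty w a : is_omega w -> is_empty a -> finite a.
Proof.
intros Hw Ha. exists w, a, a.
assert (Hr : forall x y, ~ related a x y).
{ intros x y (p & _ & Hp). exact (Ha p Hp). }
split; [exact Hw|]. split; [exact (omega_zero Hw Ha)|].
split; [split; [split|]|].
- intros p Hp. destruct (Ha p Hp).
- intros x Hx. destruct (Ha x Hx).
- intros x x' y H. destruct (Hr x y H).
- intros y Hy. destruct (Ha y Hy).
Qed.

Lemma finite_adjoin a b y : finite a -> (forall t, t ∈ b <-> t ∈ a \/ t = y) ->
  finite b.
Proof.
intros Hfin Hb. destruct (classic (y ∈ a)) as [Hya | Hya].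
{ replace b with a; [exact Hfin|]. apply set_ext; intro t. rewrite (Hb t).
  split; [tauto|]. intros [? | ->]; auto. }
destruct Hfin as (w & n & f & Hw & Hn & ((Hf & Hinj) & Hsurj)).
destruct (adjoin_exists n n) as [s Hs].
destruct (is_opair_exists n y) as [q Hq].
destruct (adjoin_exists f q) as [g Hg].
assert (Hrel : forall m z, related g m z <-> related f m z \/ m = n /\ z = y).
{ intros m z; split.
  - intros (p & Hp & H). apply Hg in H. destruct H as [H | ->].
    + left; exists p; auto.
    + right. exact (is_opair_inj Hp Hq).
  - intros [(p & Hp & H) | [-> ->]].
    + exists p; split; [exact Hp | apply Hg; auto].
    + exists q; split; [exact Hq | apply Hg; auto]. }
assert (Hdom : forall m z, related f m z -> m ∈ n /\ z ∈ a).
{ intros m z. apply related_domain. apply Hf. }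
exists w, s, g. split; [exact Hw|]. split; [exact (omega_succ Hw Hn Hs)|].
split; [split; [split|]|].
- intros p Hp. apply Hg in Hp. destruct Hp as [Hp | ->].
  + destruct Hf as [Hf _]. destruct (Hf p Hp) as (i & z & Hi & Hz & Hp').
    exists i, z. split; [apply Hs; auto|]. split; [apply Hb; auto|auto].
  + exists n, y. split; [apply Hs; auto|]. split; [apply Hb; auto|auto].
- intros i Hi. apply Hs in Hi. destruct Hi as [Hi | ->].
  + destruct Hf as [_ Hf]. destruct (Hf i Hi) as (z & Hz & Hu).
    exists z; split; [apply Hrel; auto|].
    intros z' Hz'. apply Hrel in Hz'. destruct Hz' as [Hz' | [-> _]]; [auto|].
    destruct (mem_irrefl Hi).
  + exists y; split; [apply Hrel; auto|].
    intros z' Hz'. apply Hrel in Hz'. destruct Hz' as [Hz' | [_ ->]]; [|auto].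
    destruct (mem_irrefl (proj1 (Hdom _ _ Hz'))).
- intros i i' z Hi Hi'. apply Hrel in Hi, Hi'.
  destruct Hi as [Hi | [-> ->]], Hi' as [Hi' | [-> E]]; auto.
  + eauto.
  + subst z. destruct (Hya (proj2 (Hdom _ _ Hi))).
  + destruct (Hya (proj2 (Hdom _ _ Hi'))).
- intros z Hz. apply Hb in Hz. destruct Hz as [Hz | ->].
  + destruct (Hsurj z Hz) as [i Hi]. exists i; apply Hrel; auto.
  + exists n; apply Hrel; auto.
Qed.

(** By induction on k, the elements of b among the values of f at arguments
    below k form a finite set. *)
Lemma finite_subset a b : finite a -> b ⊆ a -> finite b.
Proof.
intros (w & n & f & Hw & Hn & ((Hf & _) & Hsurj)) Hba.
assert (H : forall k, k ∈ w -> exists c, finite c /\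
  forall y, y ∈ c <-> y ∈ b /\ exists m, m ∈ k /\ related f m y).
{ refine (omega_induction Hw _ _ _); cbv beta.
  - definability.
  - intros z Hz. exists z; split; [exact (finite_empty Hw Hz)|].
    intro y; split.
    + intro Hy. destruct (Hz y Hy).
    + intros (_ & m & Hm & _). destruct (Hz m Hm).
  - intros k s Hk Hs (c & Hc & Hcb).
    destruct (classic (exists y, y ∈ b /\ related f k y))
      as [(y & Hyb & Hy) | Hno].
    + destruct (adjoin_exists c y) as [d Hd]. exists d.
      split; [exact (finite_adjoin Hc Hd)|].
      intro z. rewrite (Hd z), (Hcb z). split.
      * intros [(Hz & m & Hm & Hmz) | ->].
        -- split; [exact Hz|]. exists m; split; [apply Hs; auto|exact Hmz].
        -- split; [exact Hyb|]. exists k; split; [apply Hs; auto|exact Hy].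
      * intros (Hz & m & Hm & Hmz). apply Hs in Hm. destruct Hm as [Hm | ->].
        -- left; eauto.
        -- right. exact (function_unique Hf Hmz Hy).
    + exists c; split; [exact Hc|]. intro z. rewrite (Hcb z). split.
      * intros (Hz & m & Hm & Hmz). split; [exact Hz|].
        exists m; split; [apply Hs; auto|exact Hmz].
      * intros (Hz & m & Hm & Hmz). split; [exact Hz|].
        apply Hs in Hm. destruct Hm as [Hm | ->]; [eauto|].
        destruct Hno; eauto. }
destruct (H n Hn) as (c & Hc & Hcb).
replace b with c; [exact Hc|]. apply set_ext; intro y. rewrite (Hcb y).
split; [tauto|]. intro Hy. split; [exact Hy|].
destruct (Hsurj y (Hba y Hy)) as [m Hm]. exists m; split; [|exact Hm].
exact (proj1 (related_domain (proj1 Hf) Hm)).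
Qed.

End Sets.

(** * Topology *)

Section Topology.

Variable M : set_structure.
Hypothesis HZF : ZF M.
Variables X T : M.
Hypothesis HT : is_topology X T.
Implicit Types A B C D F K U V W f g i n s w x y z : M.

(** U is the union of all open subsets of U, so no neighbourhoods need to be
    chosen. *)
Lemma open_of_neighbourhoods U : U ⊆ X ->
  (forall x, x ∈ U -> exists V, V ∈ T /\ x ∈ V /\ V ⊆ U) -> U ∈ T.
Proof.
intros HU H.
destruct (separation HZF (P := fun V => V ⊆ U) T) as [C HC];
  [definability|].
destruct (open_union HT (C := C)) as (U' & HU' & HT').
- intros V HV. apply HC in HV. tauto.
- replace U with U'; [exact HT'|]. apply (set_ext HZF); intro t.
  rewrite (HU' t). split.
  + intros (V & HV & Ht). apply HC in HV. apply HV, Ht.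
  + intro Ht. destruct (H t Ht) as (V & HV & HtV & HVU).
    exists V; split; [apply HC; auto | exact HtV].
Qed.

Lemma is_closed_iff A : is_closed X T A <->
  A ⊆ X /\ forall x, x ∈ X -> x ∉ A ->
    exists V, V ∈ T /\ x ∈ V /\ forall t, t ∈ V -> t ∉ A.
Proof.
split.
- intros (HA & U & HU & HUT). split; [exact HA|]. intros x Hx HxA.
  exists U; split; [exact HUT|]. split; [apply HU; auto|].
  intros t Ht. apply HU in Ht. tauto.
- intros [HA H]. split; [exact HA|].
  destruct (separation HZF (P := fun t => t ∉ A) X) as [U HU];
    [definability|].
  exists U; split; [exact HU|]. apply open_of_neighbourhoods.
  + intros t Ht. apply HU in Ht. tauto.
  + intros x Hx. apply HU in Hx. destruct (H x (proj1 Hx) (proj2 Hx))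
      as (V & HV & HxV & HVA).
    exists V; split; [exact HV|]. split; [exact HxV|]. intros t Ht.
    apply HU; split; [exact (open_sub HT HV Ht) | exact (HVA t Ht)].
Qed.

Lemma remove_exists A x : exists B, is_remove B A x.
Proof. apply (separation HZF (P := fun t => t <> x) A). definability. Qed.

Lemma is_sequence_sub s A B : A ⊆ B -> is_sequence s A -> is_sequence s B.
Proof.
intros HAB (w & Hw & Hs & Hu). exists w; split; [exact Hw|].
split; [|exact Hu]. intros p Hp. destruct (Hs p Hp) as (i & y & Hi & Hy & Hp').
exists i, y; auto.
Qed.

Lemma accumulation_point_not_closed F A x : accumulation_point X T F x ->
  is_remove A F x -> ~ is_closed X T A.
Proof.
intros [Hx Hacc] HA Hcl. apply is_closed_iff in Hcl. destruct Hcl as [_ Hcl].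
destruct (Hcl x Hx) as (V & HV & HxV & HVA).
- intro HxA. apply HA in HxA. tauto.
- destruct (Hacc V HV HxV) as (y & HyV & HyF & Hyx).
  apply (HVA y HyV). apply HA; auto.
Qed.

Lemma sequential_WUF : sequential X T -> WUF X T.
Proof.
intros Hseq F x HF Hacc. destruct (remove_exists F x) as [A HA].
assert (HAF : A ⊆ F) by (intros t Ht; apply HA in Ht; tauto).
assert (Hns : ~ sequentially_closed X T A).
{ intro H. apply (accumulation_point_not_closed Hacc HA). apply Hseq, H. }
apply NNPP; intro Hno. apply Hns. split.
{ intros t Ht. apply (proj1 HF), HAF, Ht. }
intros s y Hs Hsy. apply HA.
assert (HyF : y ∈ F).
{ apply Hseq in HF. destruct HF as [_ HF]. apply (HF s y); [|exact Hsy].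
  exact (is_sequence_sub HAF Hs). }
split; [exact HyF|]. intros ->. apply Hno. exists A, s; auto.
Qed.

(** The cover consists of all open sets disjoint from some neighbourhood of x;
    the induction along the enumeration f of a finite subcover D then produces
    one neighbourhood of x disjoint from every member of D. *)
Lemma compact_closed K : hausdorff X T -> is_compact X T K -> is_closed X T K.
Proof.
intros HH [HKX HK]. apply is_closed_iff. split; [exact HKX|]. intros x Hx HxK.
destruct (separation HZF
  (P := fun U => exists V, V ∈ T /\ x ∈ V /\ forall t, t ∈ V -> t ∉ U) T)
  as [C HC]; [definability|].
destruct (HK C) as (D & HDC & (w & n & f & Hw & Hn & ((Hf & _) & Hsurj)) & HDK).
{ intros U HU. apply HC in HU. tauto. }
{ intros y Hy.
  destruct (HH x y Hx (HKX y Hy)) as (V & U & HV & HU & HxV & HyU & HVU).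
  { intros ->. auto. }
  exists U; split; [apply HC|]; eauto. }
assert (H : forall k, k ∈ w -> exists V, V ∈ T /\ x ∈ V /\
  forall m U t, m ∈ k -> related f m U -> t ∈ V -> t ∉ U).
{ refine (omega_induction HZF Hw _ _ _); cbv beta.
  - definability.
  - intros z Hz. exists X. split; [exact (open_whole HT)|].
    split; [exact Hx|]. intros m U t Hm. destruct (Hz m Hm).
  - intros k s Hk Hs (V & HV & HxV & H).
    destruct (classic (exists U, related f k U)) as [[U HU] | Hno].
    + assert (HUC : U ∈ C).
      { apply HDC. exact (proj2 (related_domain (proj1 Hf) HU)). }
      apply HC in HUC. destruct HUC as (_ & V' & HV' & HxV' & HVU).
      destruct (open_inter HT HV HV') as (W & HW & HWT).
      exists W. split; [exact HWT|]. split; [apply HW; auto|].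
      intros m U' t Hm HU' Ht. apply HW in Ht. apply Hs in Hm.
      destruct Hm as [Hm | ->].
      * exact (H m U' t Hm HU' (proj1 Ht)).
      * rewrite (function_unique Hf HU' HU). apply HVU, Ht.
    + exists V; split; [exact HV|]. split; [exact HxV|].
      intros m U t Hm HU. apply Hs in Hm. destruct Hm as [Hm | ->]; [eauto|].
      destruct Hno; eauto. }
destruct (H n Hn) as (V & HV & HxV & HVD).
exists V; split; [exact HV|]. split; [exact HxV|]. intros t Ht HtK.
destruct (HDK t HtK) as (U & HU & HtU). destruct (Hsurj U HU) as [m Hm].
exact (HVD m U t (proj1 (related_domain (proj1 Hf) Hm)) Hm Ht HtU).
Qed.

Lemma hausdorff_WUF_CUF : hausdorff X T -> WUF X T -> CUF X T.
Proof.
intros HH HW F x HF. apply HW. exact (compact_closed HH HF).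
Qed.

Lemma closed_inter A B C : is_closed X T A -> is_closed X T B ->
  is_inter C A B -> is_closed X T C.
Proof.
intros HA HB HC. apply is_closed_iff in HA, HB. apply is_closed_iff.
destruct HA as [HAX HA], HB as [_ HB]. split.
{ intros t Ht. apply HC in Ht. apply HAX, Ht. }
intros x Hx HxC. destruct (classic (x ∈ A)) as [HxA | HxA].
- destruct (HB x Hx) as (V & HV & HxV & HVB).
  { intro HxB. apply HxC, HC; auto. }
  exists V; split; [exact HV|]. split; [exact HxV|].
  intros t Ht HtC. apply HC in HtC. apply (HVB t Ht), HtC.
- destruct (HA x Hx HxA) as (V & HV & HxV & HVA).
  exists V; split; [exact HV|]. split; [exact HxV|].
  intros t Ht HtC. apply HC in HtC. apply (HVA t Ht), HtC.
Qed.

Lemma closed_inter_compact F K L : is_closed X T F -> is_compact X T K ->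
  is_inter L F K -> is_compact X T L.
Proof.
intros [HFX (O & HO & HOT)] [HKX HK] HL. split.
{ intros t Ht. apply HL in Ht. apply HFX, Ht. }
(* O is the complement of F: a cover of F ∩ K together with O covers K. *)
intros C HCT HCL. destruct (adjoin_exists HZF C O) as [C' HC'].
destruct (HK C') as (D & HDC & HDfin & HDK).
{ intros U HU. apply HC' in HU. destruct HU as [HU | ->]; auto. }
{ intros x Hx. destruct (classic (x ∈ F)) as [HxF | HxF].
  - destruct (HCL x) as (U & HU & HxU); [apply HL; auto|].
    exists U; split; [apply HC'; auto | exact HxU].
  - exists O; split; [apply HC'; auto | apply HO; auto]. }
destruct (separation HZF (P := fun U => U ∈ C) D) as [E HE]; [definability|].
exists E. split; [intros U HU; apply HE in HU; tauto|]. split.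
{ apply (finite_subset HZF HDfin). intros U HU. apply HE in HU. tauto. }
intros x Hx. apply HL in Hx. destruct (HDK x (proj2 Hx)) as (U & HU & HxU).
exists U; split; [|exact HxU]. apply HE. split; [exact HU|].
apply HDC in HU. apply HC' in HU. destruct HU as [HU | ->]; [exact HU|].
apply HO in HxU. tauto.
Qed.

Lemma k_space_CUF_WUF : k_space X T -> CUF X T -> WUF X T.
Proof.
intros [HH Hk] HC F x HF Hacc. destruct (remove_exists F x) as [A HA].
assert (HAF : A ⊆ F) by (intros t Ht; apply HA in Ht; tauto).
pose proof (proj1 (proj1 (is_closed_iff F) HF)) as HFX.
apply NNPP; intro Hno. apply (accumulation_point_not_closed Hacc HA).
apply Hk; [intros t Ht; auto|]. intros K HK.
destruct (separation HZF (P := fun t => t ∈ K) A) as [I HI]; [definability|].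
exists I; split; [exact HI|].
destruct (separation HZF (P := fun t => t ∈ K) F) as [L HL]; [definability|].
pose proof (closed_inter HF (compact_closed HH HK) HL) as HLcl.
pose proof (closed_inter_compact HF HK HL) as HLcp.
assert (HILx : forall t, t ∈ I <-> t ∈ L /\ t <> x).
{ intro t. rewrite (HI t), (HA t), (HL t). tauto. }
apply is_closed_iff in HLcl. apply is_closed_iff. split.
{ intros t Ht. apply HILx in Ht. apply HLcl, Ht. }
intros y Hy HyI. destruct (classic (y = x)) as [-> | Hyx].
- (* A neighbourhood of x that misses F ∩ K outside x would do. *)
  apply NNPP; intro HnV.
  assert (HaccL : accumulation_point X T L x).
  { split; [exact Hy|]. intros U HU HxU. apply NNPP; intro Hn. apply HnV.
    exists U; split; [exact HU|]. split; [exact HxU|]. intros t Ht HtI.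
    apply HILx in HtI. apply Hn. exists t; tauto. }
  destruct (HC L x HLcp HaccL) as (A' & s & HA' & Hs & Hsx).
  apply Hno. exists A, s; split; [exact HA|]. split; [|exact Hsx].
  apply (is_sequence_sub (A := A')); [|exact Hs].
  intros t Ht. apply HA' in Ht. apply HA. split; [|tauto].
  apply (HL t); tauto.
- destruct (proj2 HLcl y Hy) as (V & HV & HyV & HVL).
  { intro HyL. apply HyI, HILx; auto. }
  exists V; split; [exact HV|]. split; [exact HyV|].
  intros t Ht HtI. apply HILx in HtI. apply (HVL t Ht), HtI.
Qed.

(** z belongs to the closure of U, for a point z of X. *)
Definition in_closure U z : Prop :=
  forall V, V ∈ T -> z ∈ V -> exists u, u ∈ V /\ u ∈ U.

Lemma closed_inter_closure F U K : is_closed X T F ->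
  (forall t, t ∈ K <-> t ∈ F /\ in_closure U t) -> is_closed X T K.
Proof.
intros HF HK. apply is_closed_iff in HF. destruct HF as [HFX HF].
apply is_closed_iff. split.
{ intros t Ht. apply HK in Ht. apply HFX, Ht. }
intros x Hx HxK. destruct (classic (x ∈ F)) as [HxF | HxF].
- apply NNPP; intro Hno. apply HxK, HK. split; [exact HxF|].
  intros V HV HxV. apply NNPP; intro Hdisj. apply Hno.
  exists V; split; [exact HV|]. split; [exact HxV|].
  intros t Ht HtK. apply HK in HtK. apply Hdisj. exact (proj2 HtK V HV Ht).
- destruct (HF x Hx HxF) as (V & HV & HxV & HVF).
  exists V; split; [exact HV|]. split; [exact HxV|].
  intros t Ht HtK. apply HK in HtK. apply (HVF t Ht), HtK.
Qed.

Lemma in_closure_closed U D z : is_closed X T D -> U ⊆ D -> z ∈ X ->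
  in_closure U z -> z ∈ D.
Proof.
intros HD HUD Hz Hcl. apply is_closed_iff in HD. apply NNPP; intro HzD.
destruct (proj2 HD z Hz HzD) as (V & HV & HzV & HVD).
destruct (Hcl V HV HzV) as (u & HuV & HuU). exact (HVD u HuV (HUD u HuU)).
Qed.

(** ** Regular second-countable Loeb spaces *)

Definition T1_space : Prop :=
  forall x y, x ∈ X -> y ∈ X -> x <> y ->
    exists V, V ∈ T /\ y ∈ V /\ x ∉ V.

(** Regularity in the form used here: inside every open neighbourhood of y there
    is a closed neighbourhood of y. *)
Definition regular : Prop :=
  forall y W, W ∈ T -> y ∈ W ->
    exists U D, U ∈ T /\ is_closed X T D /\ y ∈ U /\ U ⊆ D /\ D ⊆ W.

(** U is a basic set that meets F, its closure avoids x and is contained in every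
    basic neighbourhood of x whose index under g is less than n. *)
Definition admissible B g F x n U : Prop :=
  U ∈ B /\ (exists u, u ∈ U /\ u ∈ F) /\ ~ in_closure U x /\
  forall V i, V ∈ B -> x ∈ V -> i ∈ n -> related g V i ->
    forall z, z ∈ X -> in_closure U z -> z ∈ V.

(** U is the admissible set of least index under g. *)
Definition first_admissible B g F x n U : Prop :=
  admissible B g F x n U /\
  forall U' i i', admissible B g F x n U' ->
    related g U i -> related g U' i' -> i' ∉ i.

(** y is the n-th term of the sequence: the value of the choice function f at the
    intersection of F with the closure of the first admissible set. *)
Definition selected f B g F x n y : Prop :=
  exists U K, first_admissible B g F x n U /\
    (forall t, t ∈ K <-> t ∈ F /\ in_closure U t) /\ related f K y.

Lemma admissible_exists B g F x w n : T1_space -> regular -> is_base T B ->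
  is_omega w -> is_injection g B w -> accumulation_point X T F x ->
  n ∈ w -> exists U, admissible B g F x n U.
Proof.
intros HT1 Hreg [HBT HB] Hw [Hg Hginj] [Hx Hacc] Hn.
assert (H : forall k, k ∈ w -> exists W, W ∈ T /\ x ∈ W /\
  forall V i t, V ∈ B -> x ∈ V -> i ∈ k -> related g V i -> t ∈ W -> t ∈ V).
{ refine (omega_induction HZF Hw _ _ _); cbv beta.
  - definability.
  - intros z Hz. exists X. split; [exact (open_whole HT)|].
    split; [exact Hx|]. intros V i t _ _ Hi. destruct (Hz i Hi).
  - intros k s Hk Hs (W & HW & HxW & H).
    destruct (classic (exists V, V ∈ B /\ x ∈ V /\ related g V k))
      as [(V & HV & HxV & HgV) | Hno].
    + destruct (open_inter HT HW (HBT V HV)) as (W' & HW' & HWT).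
      exists W'. split; [exact HWT|]. split; [apply HW'; auto|].
      intros V' i t HV' HxV' Hi HgV' Ht. apply HW' in Ht. apply Hs in Hi.
      destruct Hi as [Hi | ->].
      * exact (H V' i t HV' HxV' Hi HgV' (proj1 Ht)).
      * rewrite (Hginj V' V k HgV' HgV). apply Ht.
    + exists W; split; [exact HW|]. split; [exact HxW|].
      intros V i t HV HxV Hi HgV. apply Hs in Hi.
      destruct Hi as [Hi | ->]; [eauto|]. destruct Hno; eauto. }
destruct (H n Hn) as (W & HW & HxW & HWV). clear H.
(* W is contained in the basic neighbourhoods of x of index below n; regularity
   is applied at a point y of F to W minus x. *)
destruct (Hacc W HW HxW) as (y & HyW & HyF & Hyx).
destruct (HT1 x y Hx (open_sub HT HW HyW)) as (O & HO & HyO & HxO);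
  [congruence|].
destruct (open_inter HT HW HO) as (W' & HW' & HWT).
destruct (Hreg y W' HWT) as (U0 & D & HU0 & HD & HyU0 & HUD & HDW).
{ apply HW'; auto. }
destruct (HB U0 HU0) as (C & HCB & HC).
apply HC in HyU0. destruct HyU0 as (U & HU & HyU).
assert (HUs : U ⊆ D).
{ intros t Ht. apply HUD, HC. eauto. }
exists U. split; [auto|]. split; [eauto|]. split.
- intro Hcl. pose proof (in_closure_closed HD HUs Hx Hcl) as HxD.
  apply HDW, HW' in HxD. tauto.
- intros V i HV HxV Hi HgV z Hz Hcl.
  pose proof (in_closure_closed HD HUs Hz Hcl) as HzD.
  apply HDW, HW' in HzD. exact (HWV V i z HV HxV Hi HgV (proj1 HzD)).
Qed.

Lemma first_admissible_exists B g F x w n : is_omega w -> is_injection g B w ->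
  (exists U, admissible B g F x n U) ->
  exists U, first_admissible B g F x n U.
Proof.
intros Hw [Hg _] [U HU].
destruct (omega_least HZF (w := w)
  (P := fun i => exists U, admissible B g F x n U /\ related g U i))
  as (k & Hk & (U' & HU' & HgU') & Hmin).
- definability.
- destruct (proj2 Hg U (proj1 HU)) as (i & Hi & _). exists i.
  split; [exact (proj2 (related_domain (proj1 Hg) Hi)) | eauto].
- exists U'. split; [exact HU'|]. intros V i i' HV Hi Hi'.
  rewrite (function_unique Hg Hi HgU').
  apply Hmin; [exact (proj2 (related_domain (proj1 Hg) Hi')) | eauto].
Qed.

Lemma first_admissible_unique B g F x w n U U' : is_omega w ->
  is_injection g B w -> first_admissible B g F x n U ->
  first_admissible B g F x n U' -> U = U'.
Proof.
intros Hw [Hg Hginj] [HU Hmin] [HU' Hmin'].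
destruct (proj2 Hg U (proj1 HU)) as (i & Hi & _).
destruct (proj2 Hg U' (proj1 HU')) as (i' & Hi' & _).
destruct (nat_trichotomy HZF Hw
  (proj2 (related_domain (proj1 Hg) Hi))
  (proj2 (related_domain (proj1 Hg) Hi'))) as [H | [E | H]].
- destruct (Hmin' U i' i HU Hi' Hi H).
- subst i'. exact (Hginj U U' i Hi Hi').
- destruct (Hmin U' i i' HU' Hi Hi' H).
Qed.

Lemma regular_second_countable_loeb_WUF : T1_space -> regular ->
  second_countable T -> loeb X T -> WUF X T.
Proof.
intros HT1 Hreg (B & HB & w & g & Hw & Hg) (E & f & HE & Hf & Hfch) F x HF Hacc.
destruct (remove_exists F x) as [A HA].
assert (HFX : F ⊆ X) by apply HF.
assert (Hsel : forall n y, selected f B g F x n y -> exists U,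
  first_admissible B g F x n U /\ y ∈ F /\ in_closure U y).
{ intros n y (U & K & HU & HK & Hy). exists U; split; [exact HU|].
  apply HK.
  destruct (related_domain (proj1 Hf) Hy) as [HKE _].
  destruct (Hfch K HKE) as (z & HzK & Hz).
  rewrite (function_unique Hf Hy Hz). exact HzK. }
destruct (function_graph HZF (P := selected f B g F x) (a := w) (b := A))
  as (s & Hs & Hrel).
- definability.
- intros n Hn.
  destruct (first_admissible_exists Hw Hg
    (admissible_exists HT1 Hreg HB Hw Hg Hacc Hn)) as [U HU].
  destruct (separation HZF (P := in_closure U) F) as [K HK]; [definability|].
  assert (HKE : K ∈ E).
  { apply HE. split; [exact (closed_inter_closure HF HK)|].
    destruct HU as [(_ & (u & HuU & HuF) & _) _]. exists u.
    apply HK. split; [exact HuF|]. intros V HV HuV. eauto. }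
  destruct (Hfch K HKE) as (y & HyK & Hy). exists y, U, K; auto.
- intros n y y' Hn (U & K & HU & HK & Hy) (U' & K' & HU' & HK' & Hy').
  rewrite (first_admissible_unique Hw Hg HU' HU) in HK'.
  assert (K' = K) as ->.
  { apply (set_ext HZF); intro t. rewrite (HK t), (HK' t). tauto. }
  exact (function_unique Hf Hy Hy').
- intros n y Hn Hy. destruct (Hsel n y Hy) as (U & HU & HyF & Hcl).
  apply HA. split; [exact HyF|]. intros ->. apply HU, Hcl.
- assert (HsA : is_sequence s A) by (exists w; auto).
  exists A, s. split; [exact HA|]. split; [exact HsA|]. split; [|split].
  + apply (is_sequence_sub (A := A)); [|exact HsA].
    intros t Ht. apply HA in Ht. apply HFX, Ht.
  + apply Hacc.
  + intros O HO HxO. destruct (proj2 HB O HO) as (C & HCB & HC).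
    apply HC in HxO. destruct HxO as (V & HVC & HxV).
    destruct (proj2 (proj1 Hg) V (HCB V HVC)) as (k & Hk & _).
    assert (Hkw : k ∈ w) by exact (proj2 (related_domain (proj1 (proj1 Hg)) Hk)).
    (* V has index k, and constrains the terms of index greater than k. *)
    destruct (adjoin_exists HZF k k) as [k' Hk'].
    exists w, k'. split; [exact Hw|].
    split; [exact (omega_succ HZF Hw Hkw Hk')|].
    intros m Hm Hk'm y Hy. apply Hrel in Hy.
    assert (Hkm : k ∈ m).
    { destruct Hk'm as [H | <-]; [|apply Hk'; auto].
      apply (nat_transitive HZF Hw Hm H). apply Hk'; auto. }
    destruct (Hsel m y (proj2 Hy)) as (U & HU & HyF & Hcl).
    apply HC. exists V; split; [exact HVC|].
    destruct HU as [(_ & _ & _ & HU) _].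
    exact (HU V k (HCB V HVC) HxV Hkm Hk y (HFX y HyF) Hcl).
Qed.

End Topology.

(** * Real numbers and metrics *)

Section OrderedReals.

Variable M : set_structure.
Implicit Types a b c d r s x y z : M.

Lemma function2_exists f A B C x y : is_function2 f A B C ->
  x ∈ A -> y ∈ B -> exists z, z ∈ C /\ related2 f x y z.
Proof.
intros [Hf Hu] Hx Hy. destruct (Hu x y Hx Hy) as (z & Hz & _).
exists z; split; [|exact Hz]. destruct Hz as (p & Hp & q & Hq & Hqf).
destruct (Hf q Hqf) as (x' & y' & z' & p' & _ & _ & Hz' & _ & Hq').
destruct (is_opair_inj Hq Hq') as [_ ->]. exact Hz'.
Qed.

Lemma function2_unique f A B C x y z z' : is_function2 f A B C ->
  x ∈ A -> y ∈ B -> related2 f x y z -> related2 f x y z' -> z = z'.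
Proof.
intros [_ Hu] Hx Hy Hz Hz'. destruct (Hu x y Hx Hy) as (v & _ & H).
rewrite <- (H z Hz). exact (H z' Hz').
Qed.

Variables R zero one add mul le : M.
Hypothesis HR : is_reals R zero one add mul le.

Lemma less_le_trans a b c : less le a b -> related le b c -> less le a c.
Proof.
intros [Hab Hn] Hbc. split; [exact (le_trans HR Hab Hbc)|]. intros ->.
exact (Hn (le_antisym HR Hab Hbc)).
Qed.

Lemma le_less_trans a b c : related le a b -> less le b c -> less le a c.
Proof.
intros Hab [Hbc Hn]. split; [exact (le_trans HR Hab Hbc)|]. intros ->.
exact (Hn (le_antisym HR Hbc Hab)).
Qed.

Lemma less_or_le a b : a ∈ R -> b ∈ R -> less le a b \/ related le b a.
Proof.
intros Ha Hb. destruct (le_total HR Ha Hb) as [H | H]; [|auto].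
destruct (classic (a = b)) as [-> | Hn]; [auto|]. left; split; auto.
Qed.

(** The witness is r = b - a; this is the only arithmetic that the metric
    arguments need. *)
Lemma less_gap a b : a ∈ R -> b ∈ R -> less le a b ->
  exists r, r ∈ R /\ less le zero r /\
    forall c d, c ∈ R -> less le c r -> related2 add a c d -> less le d b.
Proof.
intros Ha Hb [Hab Hne].
pose proof (zero_in HR) as H0.
assert (Hu : forall x y z z', x ∈ R -> y ∈ R -> related2 add x y z ->
  related2 add x y z' -> z = z').
{ intros x y z z'. apply (function2_unique (add_function HR)). }
destruct (add_opp HR Ha) as (a' & Ha' & Haa').
destruct (function2_exists (add_function HR) Hb Ha') as (r & Hr & Hba').
pose proof (add_comm HR Ha Ha' Haa') as Ha'a.
assert (Hra : related2 add r a b).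
{ destruct (function2_exists (add_function HR) Hr Ha) as (s & Hs & Hras).
  pose proof (add_assoc HR Hb Ha' Ha Hba' Ha'a Hras) as Hb0.
  rewrite (Hu b zero b s); auto. exact (add_zero HR Hb). }
exists r. split; [exact Hr|]. split.
- split.
  + exact (add_le HR Ha Hb Ha' Hab Haa' Hba').
  + intros <-. apply Hne. apply (Hu a zero); auto.
    * exact (add_zero HR Ha).
    * exact (add_comm HR H0 Ha Hra).
- intros c d Hc [Hcr Hcn] Hacd. pose proof (add_comm HR Ha Hc Hacd) as Hcad.
  split; [exact (add_le HR Hc Hr Ha Hcr Hcad Hra)|]. intros ->.
  apply Hcn. apply (Hu c zero); auto.
  + exact (add_zero HR Hc).
  + exact (add_assoc HR Hc Ha Ha' Hcad Haa' Hba').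
Qed.

End OrderedReals.

Section Metric.

Variable M : set_structure.
Hypothesis HZF : ZF M.
Variables X T R zero add le dist : M.
Hypothesis Hdist : is_metric X dist R zero add le.
Hypothesis Hopen : forall U, U ∈ T <->
  U ⊆ X /\
  forall x, x ∈ U ->
    exists r, r ∈ R /\ less le zero r /\
      forall y b, y ∈ X -> related2 dist x y b -> less le b r -> y ∈ U.
Implicit Types a b c d r s t u v x y z U V W D : M.

Lemma dist_exists x y : x ∈ X -> y ∈ X -> exists r, r ∈ R /\ related2 dist x y r.
Proof. apply (function2_exists (dist_function Hdist)). Qed.

Lemma dist_unique x y r r' : x ∈ X -> y ∈ X ->
  related2 dist x y r -> related2 dist x y r' -> r = r'.
Proof. apply (function2_unique (dist_function Hdist)). Qed.

Lemma dist_real x y r : x ∈ X -> y ∈ X -> related2 dist x y r -> r ∈ R.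
Proof.
intros Hx Hy Hr. destruct (dist_exists Hx Hy) as (r' & Hr' & Hd).
rewrite (dist_unique Hx Hy Hr Hd). exact Hr'.
Qed.

Lemma dist_positive x y r : x ∈ X -> y ∈ X -> x <> y -> related2 dist x y r ->
  less le zero r.
Proof.
intros Hx Hy Hne Hr. split; [exact (dist_nonneg Hdist Hx Hy Hr)|]. intros <-.
apply Hne, (dist_zero Hdist Hx Hy), Hr.
Qed.

Lemma point_complement_open x U : x ∈ X ->
  (forall z, z ∈ U <-> z ∈ X /\ z <> x) -> U ∈ T.
Proof.
intros Hx HU. apply Hopen. split; [intros z Hz; apply HU in Hz; tauto|].
intros z Hz. apply HU in Hz. destruct Hz as [Hz Hzx].
destruct (dist_exists Hz Hx) as (r & Hr & Hd).
exists r. split; [exact Hr|]. split; [exact (dist_positive Hz Hx Hzx Hd)|].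
intros v b Hv Hb [_ Hbr]. apply HU. split; [exact Hv|]. intros ->.
exact (Hbr (dist_unique Hz Hx Hb Hd)).
Qed.

Lemma metric_T1_space : T1_space X T.
Proof.
intros x y Hx Hy Hxy.
destruct (separation HZF (P := fun z => z <> x) X) as [U HU]; [definability|].
exists U. split; [exact (point_complement_open Hx HU)|]. split.
- apply HU; auto.
- intro H. apply HU in H. tauto.
Qed.

Variables one mul : M.
Hypothesis HT : is_topology X T.
Hypothesis HR : is_reals R zero one add mul le.

Lemma open_ball_open y r U : y ∈ X -> r ∈ R ->
  (forall z, z ∈ U <-> z ∈ X /\ exists d, related2 dist y z d /\ less le d r) ->
  U ∈ T.
Proof.
intros Hy Hr HU. apply Hopen. split; [intros z Hz; apply HU in Hz; tauto|].
intros z Hz. apply HU in Hz. destruct Hz as (Hz & d & Hd & Hdr).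
pose proof (dist_real Hy Hz Hd) as HdR.
destruct (less_gap HR HdR Hr Hdr) as (q & Hq & Hq0 & Hgap).
exists q. split; [exact Hq|]. split; [exact Hq0|].
intros v c Hv Hc Hcq. apply HU. split; [exact Hv|].
destruct (dist_exists Hy Hv) as (b & _ & Hb). exists b; split; [exact Hb|].
pose proof (dist_real Hz Hv Hc) as HcR.
destruct (function2_exists (add_function HR) HdR HcR) as (s & _ & Hs).
apply (le_less_trans HR (b := s)).
- exact (dist_triangle Hdist Hy Hz Hv Hd Hc Hb Hs).
- exact (Hgap c s HcR Hcq Hs).
Qed.

Lemma closed_ball_closed y r D : y ∈ X -> r ∈ R ->
  (forall z, z ∈ D <->
     z ∈ X /\ exists d, related2 dist y z d /\ related le d r) ->
  is_closed X T D.
Proof.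
intros Hy Hr HD. split; [intros z Hz; apply HD in Hz; tauto|].
destruct (separation HZF (P := fun z => z ∉ D) X) as [U HU]; [definability|].
exists U. split; [exact HU|]. apply Hopen.
split; [intros z Hz; apply HU in Hz; tauto|].
intros z Hz. apply HU in Hz. destruct Hz as [Hz HzD].
destruct (dist_exists Hy Hz) as (d & HdR & Hd).
assert (Hrd : less le r d).
{ destruct (less_or_le HR Hr HdR) as [H | H]; [exact H|].
  destruct HzD. apply HD; eauto. }
destruct (less_gap HR Hr HdR Hrd) as (q & Hq & Hq0 & Hgap).
exists q. split; [exact Hq|]. split; [exact Hq0|].
intros v c Hv Hc Hcq. apply HU. split; [exact Hv|]. intro HvD.
apply HD in HvD. destruct HvD as (_ & b & Hb & Hbr).
pose proof (dist_real Hy Hv Hb) as HbR.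
pose proof (dist_real Hz Hv Hc) as HcR.
destruct (function2_exists (add_function HR) HbR HcR) as (s & HsR & Hs).
destruct (function2_exists (add_function HR) Hr HcR) as (s' & _ & Hs').
pose proof (dist_triangle Hdist Hy Hv Hz Hb (dist_sym Hdist Hz Hv Hc) Hd Hs)
  as Hds.
pose proof (add_le HR HbR Hr HcR Hbr Hs Hs') as Hss'.
pose proof (less_le_trans HR (Hgap c s' HcR Hcq Hs')
  (le_trans HR Hds Hss')) as [_ Hn].
exact (Hn eq_refl).
Qed.

(** If some z other than y is at distance d < r from y, the open and closed balls
    of radius d about y serve; otherwise the ball of radius r about y is the
    singleton of y, which is both open and closed.  This spares the halving of
    r. *)
Lemma metric_regular : regular X T.
Proof.
intros y W HW HyW. pose proof (open_sub HT HW HyW) as Hy.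
pose proof (proj2 (proj1 (Hopen W) HW) y HyW) as (r & Hr & Hr0 & Hball).
destruct (classic (exists z, z ∈ X /\ z <> y /\
    exists d, related2 dist y z d /\ less le d r))
  as [(z & Hz & Hzy & d & Hd & Hdr) | Hisol].
- destruct (separation HZF (P := fun v => exists c, related2 dist y v c /\
    less le c d) X) as [U HU]; [definability|].
  destruct (separation HZF (P := fun v => exists c, related2 dist y v c /\
    related le c d) X) as [D HD]; [definability|].
  pose proof (dist_real Hy Hz Hd) as HdR.
  exists U, D. split; [exact (open_ball_open Hy HdR HU)|].
  split; [exact (closed_ball_closed Hy HdR HD)|]. split; [|split].
  + apply HU. split; [exact Hy|]. exists zero. split.
    * apply (dist_zero Hdist Hy Hy); reflexivity.
    * apply (dist_positive Hy Hz); auto.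
  + intros t Ht. apply HU in Ht. apply HD. destruct Ht as (Ht & c & Hc & [Hcd _]).
    eauto.
  + intros t Ht. apply HD in Ht. destruct Ht as (Ht & c & Hc & Hcd).
    apply (Hball t c Ht Hc). exact (le_less_trans HR Hcd Hdr).
- destruct (ZF_pairing HZF y y) as [U HU].
  assert (HUy : forall t, t ∈ U <-> t = y).
  { intro t. rewrite (HU t). tauto. }
  destruct (separation HZF (P := fun z => z <> y) X) as [O HO]; [definability|].
  exists U, U. split.
  { apply Hopen. split; [intros t Ht; apply HUy in Ht; subst t; exact Hy|].
    intros t Ht. apply HUy in Ht. subst t. exists r.
    split; [exact Hr|]. split; [exact Hr0|].
    intros v c Hv Hc Hcr. apply HUy. apply NNPP; intro Hvy.
    apply Hisol. exists v; eauto. }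
  split.
  { split; [intros t Ht; apply HUy in Ht; subst t; exact Hy|].
    exists O. split; [|exact (point_complement_open Hy HO)].
    intro t. rewrite (HO t), (HUy t). tauto. }
  split; [apply HUy; reflexivity|]. split; [auto|].
  intros t Ht. apply HUy in Ht. subst t. exact HyW.
Qed.

End Metric.

Theorem proposition6p14 (M : set_structure) (HZF : ZF M) :
  (forall X T : M, is_topology X T -> sequential X T -> WUF X T) /\
  (forall X T : M, is_topology X T -> second_countable T -> metrizable X T ->
     loeb X T -> WUF X T) /\
  (forall X T : M, is_topology X T -> hausdorff X T -> WUF X T -> CUF X T) /\
  (forall X T : M, is_topology X T -> k_space X T -> (WUF X T <-> CUF X T)).
Proof.
split; [|split; [|split]]; intros X T HT.
- exact (sequential_WUF HZF HT).
- intros Hsc (R & zero & one & add & mul & le & dist & HR & Hdist & Hopen).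
  apply (regular_second_countable_loeb_WUF HZF HT); [| |exact Hsc].
  + exact (metric_T1_space HZF Hdist Hopen).
  + exact (metric_regular HZF Hdist Hopen HT HR).
- exact (hausdorff_WUF_CUF HZF HT).
- intro Hk. split.
  + apply (hausdorff_WUF_CUF HZF HT), Hk.
  + exact (k_space_CUF_WUF HZF HT Hk).
Qed.
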